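(* For every integer $n\ge3$, $$S_n^{D,+}-S_n^{D,-}=S_{n-2}^{D,-}-S_{n-2}^{D,+},\qquad S_n^{B-D,+}-S_n^{B-D,-}=S_{n-2}^{B-D,-}-S_{n-2}^{B-D,+}.$$ Consequently, for every positive integer $n$, $$S_n^{D,+}-S_n^{D,-}=\begin{cases}1& n\equiv0,1\pmod4,\\ -1& n\equiv 2,3\pmod 4,\end{cases}\qquad S_n^{B-D,+}-S_n^{B-D,-}=0.$$
   Context: $\mathfrak{B}_n$ is the group of signed permutations in window notation $\pi=\pi_1\cdots\pi_n$ ($\pi_i\in\{\pm1,\dots,\pm n\}$, $\{|\pi_i|\}=[n]$), and $\mathfrak{D}_n$ the subset with an even number of negative entries. For $\pi\in\mathfrak{B}_n$, $\mathrm{inv}_D(\pi)=|\{i<j:\pi_i>\pi_j\}|+|\{i<j:-\pi_i>\pi_j\}|$. A snake is $\pi\in\mathfrak{B}_n$ with $0<\pi_1>\pi_2<\pi_3>\cdots$. $S_n^{D,+}$ (resp. $S_n^{D,-}$) is the number of snakes in $\mathfrak{D}_n$ with $\mathrm{inv}_D$ even (resp. odd); $S_n^{B-D,+}$ (resp. $S_n^{B-D,-}$) is the number of snakes in $\mathfrak{B}_n\setminus\mathfrak{D}_n$ with $\mathrm{inv}_D$ even (resp. odd). *)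

(* Defs.v *)
From mathcomp Require Import all_boot all_order all_fingroup all_algebra.

Set Implicit Arguments.
Unset Strict Implicit.
Unset Printing Implicit Defensive.

Import Order.TTheory GRing.Theory Num.Theory.
Local Open Scope ring_scope.

(* A signed permutation is encoded as the permutation |pi| together with the
   set of positions (a boolean function) carrying a minus sign. Positions are
   numbered from 0 and values from 1: [window pi i] is pi_(i+1).  The lemma
   [windowP] shows that the windows are exactly the words pi_1 ... pi_n in
   {±1, ..., ±n} with {|pi_i|} = [n], each obtained from a unique encoding. *)
Definition signed_perm (n : nat) : finType := ('S_n * {ffun 'I_n -> bool})%type.

Definition window n (pi : signed_perm n) (i : 'I_n) : int :=
  (-1) ^+ pi.2 i * (pi.1 i).+1%:Z.

Lemma absz_window n (pi : signed_perm n) i : `|window pi i|%N = (pi.1 i).+1.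
Proof. by rewrite /window abszM abszX exp1n mul1n. Qed.

Lemma window_lt0 n (pi : signed_perm n) i : (window pi i < 0) = pi.2 i.
Proof. by rewrite /window; case: (pi.2 i); rewrite ?expr1 ?mulN1r ?mul1r. Qed.

Lemma window_inj n (pi rho : signed_perm n) : window pi =1 window rho -> pi = rho.
Proof.
case: pi rho => [s e] [t f] eqw; congr pair.
  apply/permP => i; apply/val_inj/succn_inj.
  by rewrite -(absz_window (s, e)) -(absz_window (t, f)) eqw.
by apply/ffunP => i; rewrite -(window_lt0 (s, e)) -(window_lt0 (t, f)) eqw.
Qed.

Lemma windowP n (w : 'I_n -> int) :
  (forall k : nat, (0 < k <= n)%N <-> exists i, `|w i|%N = k) <->
  exists! pi : signed_perm n, window pi =1 w.
Proof.
split=> [absw | [pi [piw _]] k]; last first.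
  split=> [/andP[k_gt0 le_k_n] | [i <-]]; last by rewrite -piw absz_window ltn_ord.
  have ltk : (k.-1 < n)%N by rewrite prednK.
  exists ((pi.1)^-1%g (Ordinal ltk)).
  by rewrite -piw absz_window permKV /= prednK.
have wP i : (0 < `|w i| <= n)%N by apply/absw; exists i.
have ltw i : (`|w i|.-1 < n)%N by case/andP: (wP i) => w_gt0; rewrite prednK.
pose a i := Ordinal (ltw i).
have aS i : (a i).+1 = `|w i|%N by rewrite /= prednK //; case/andP: (wP i).
have a_surj j : exists i, a i == j.
  have [|i wi] := (absw j.+1).1; first exact: ltn_ord.
  by exists i; apply/eqP/val_inj/succn_inj; rewrite aS.
pose b j := xchoose (a_surj j).
have bK : cancel b a by move=> j; apply/eqP/(xchooseP (a_surj j)).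
have a_inj : injective a by apply: can_inj (canF_sym bK).
exists (perm a_inj, [ffun i => w i < 0]); split=> [i | rho rhow].
  by rewrite /window /= permE ffunE aS abszE -intEsign.
by apply/esym/window_inj => i; rewrite rhow /window /= permE ffunE aS abszE -intEsign.
Qed.

Definition in_D n (pi : signed_perm n) : bool :=
  ~~ odd #|[set i | window pi i < 0]|.

Definition inv_D n (pi : signed_perm n) : nat :=
  (#|[set p : 'I_n * 'I_n | (p.1 < p.2)%N && (window pi p.1 > window pi p.2)%R]| +
   #|[set p : 'I_n * 'I_n | (p.1 < p.2)%N && (- window pi p.1 > window pi p.2)%R]|)%N.

(* 0 < pi_1 > pi_2 < pi_3 > ...; with positions numbered from 0, the descents
   are at the even positions. *)
Definition snake n (pi : signed_perm n) : bool :=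
  [forall i : 'I_n, (i == 0%N :> nat) ==> (0 < window pi i)] &&
  [forall i : 'I_n, forall j : 'I_n, (j == i.+1 :> nat) ==>
    (if odd i then window pi i < window pi j else window pi i > window pi j)].

Definition S_D_plus (n : nat) : nat :=
  #|[set pi : signed_perm n | [&& snake pi, in_D pi & ~~ odd (inv_D pi)]]|.
Definition S_D_minus (n : nat) : nat :=
  #|[set pi : signed_perm n | [&& snake pi, in_D pi & odd (inv_D pi)]]|.
Definition S_BD_plus (n : nat) : nat :=
  #|[set pi : signed_perm n | [&& snake pi, ~~ in_D pi & ~~ odd (inv_D pi)]]|.
Definition S_BD_minus (n : nat) : nat :=
  #|[set pi : signed_perm n | [&& snake pi, ~~ in_D pi & odd (inv_D pi)]]|.

(* Main.v *)
Require Import Defs.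
From mathcomp Require Import all_boot all_order all_fingroup all_algebra.
From mathcomp Require Import zify.

(** The parity of [inv_D pi] is that of the inversion number of |pi|.  Exchanging
    the two largest absolute values n - 1 and n, with signs kept in place, is thus
    a sign-reversing involution preserving membership in D_n.  It breaks the snake
    condition only when these two entries are adjacent with equal signs; being
    extreme, they then have to be the last two entries, namely n, n-1 for n even
    and -n, -(n-1) for n odd.  Erasing them leaves an arbitrary snake of length
    n - 2, in the same class, whose absolute value has one inversion less. *)

Set Implicit Arguments.
Unset Strict Implicit.
Unset Printing Implicit Defensive.

Import Order.TTheory GRing.Theory Num.Theory.
Local Open Scope ring_scope.

(** * Parity of inversions and signed counts of snakes *)

Definition inv_parity n (s : 'S_n) : bool :=
  \big[addb/false]_(p : 'I_n * 'I_n) ((p.1 < p.2)%N && (s p.2 < s p.1)%N).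

Lemma odd_sum (I : finType) (F : I -> nat) :
  odd (\sum_i F i) = \big[addb/false]_i odd (F i).
Proof. exact: (big_morph odd oddD). Qed.

Lemma odd_card (I : finType) (P : pred I) :
  odd #|[set i | P i]| = \big[addb/false]_i P i.
Proof.
rewrite cardsE -sum1_card big_mkcond odd_sum; apply: eq_bigr => i _.
by rewrite unfold_in; case: (P i).
Qed.

Lemma windowE n (pi : signed_perm n) i :
  window pi i = if pi.2 i then - (pi.1 i).+1%:Z else (pi.1 i).+1%:Z.
Proof. by rewrite /window; case: (pi.2 i); rewrite ?expr1 ?mulN1r ?mul1r. Qed.

(** For i < j, if |pi_i| > |pi_j| then exactly one of pi_i, -pi_i exceeds pi_j; otherwise both or
    neither do. Modulo 2, each pair thus counts an inversion of |pi|. *)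
Lemma odd_inv_D n (pi : signed_perm n) : odd (inv_D pi) = inv_parity pi.1.
Proof.
rewrite /inv_D oddD !odd_card -big_split; apply: eq_bigr => -[i j] _ /=.
case: ltnP => //= ij; rewrite !windowE.
have : pi.1 i != pi.1 j by rewrite (inj_eq perm_inj) -val_eqE /=; lia.
by rewrite -val_eqE /=; case: (pi.2 i); case: (pi.2 j); lia.
Qed.

(** The flag [c] lets a single recurrence serve both D_n and its complement. *)
Definition signed_count n (c : bool) : int :=
  \sum_(pi : signed_perm n | snake pi && (in_D pi == c)) (-1) ^+ inv_parity pi.1.

Lemma card_signed (I : finType) (P Q : pred I) :
  #|[set x | P x & ~~ Q x]|%:Z - #|[set x | P x & Q x]|%:Z
    = \sum_(x | P x) (-1) ^+ Q x.
Proof.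
rewrite (bigID Q) /= addrC; congr (_ + _).
  rewrite (eq_bigr (fun=> 1)) => [|x /andP[_ /negbTE->] //].
  by rewrite sumr_const cardsE natz.
rewrite (eq_bigr (fun=> -1)) => [|x /andP[_ ->] //].
by rewrite sumr_const cardsE mulNrn natz.
Qed.

Lemma S_D_signed n : (S_D_plus n)%:Z - (S_D_minus n)%:Z = signed_count n true.
Proof.
rewrite /signed_count (eq_bigl (fun pi => snake pi && in_D pi)) => [|pi]; last first.
  by rewrite eqb_id.
rewrite -card_signed; congr (_%:Z - _%:Z); apply: eq_card => pi;
  by rewrite !inE odd_inv_D andbA.
Qed.

Lemma S_BD_signed n : (S_BD_plus n)%:Z - (S_BD_minus n)%:Z = signed_count n false.
Proof.
rewrite /signed_count (eq_bigl (fun pi => snake pi && ~~ in_D pi)) => [|pi]; last first.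
  by rewrite eqbF_neg.
rewrite -card_signed; congr (_%:Z - _%:Z); apply: eq_card => pi;
  by rewrite !inE odd_inv_D andbA.
Qed.

Lemma snakeP n (pi : signed_perm n) :
  reflect ((forall i : 'I_n, i = 0%N :> nat -> 0 < window pi i) /\
           (forall i j : 'I_n, j = i.+1 :> nat ->
             if odd i then window pi i < window pi j else window pi j < window pi i))
          (snake pi).
Proof.
apply: (iffP andP) => -[s0 sS]; split.
- by move=> i /eqP; apply/implyP; move/forallP: s0.
- move=> i j /eqP ji; move/forallP/(_ i)/forallP/(_ j)/implyP: sS; exact.
- by apply/forallP => i; apply/implyP => /eqP; apply: s0.
- apply/forallP => i; apply/forallP => j; apply/implyP => /eqP; exact: sS.
Qed.

(** * The last two positions and the two largest values *)

Section TopTwo.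

Variable m : nat.
Implicit Types (pi : signed_perm m.+2) (rho : signed_perm m).

(** Lifts past [ord_max] have the shape on which [unlift] and [lift_perm] simplify. Used as values,
    [penult] and [ord_max] encode the absolute values m + 1 and m + 2. *)
Definition penult : 'I_m.+2 := lift ord_max ord_max.

Definition wid (i : 'I_m) : 'I_m.+2 := lift ord_max (lift ord_max i).

Lemma penultE : penult = m :> nat.
Proof. by rewrite lift_max. Qed.

Lemma widE i : wid i = i :> nat.
Proof. by rewrite !lift_max. Qed.

Variant pos_spec : 'I_m.+2 -> Type :=
  | PosWid i : pos_spec (wid i)
  | PosPenult : pos_spec penult
  | PosMax : pos_spec ord_max.

Lemma posP i : pos_spec i.
Proof.
case: (unliftP ord_max i) => [j|] ->; last exact: PosMax.
case: (unliftP ord_max j) => [k|] ->; [exact: PosWid | exact: PosPenult].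
Qed.

(** * Exchange of the two largest absolute values *)

(** Products of permutations apply the left factor first, so the transposition acts on values. *)
Definition swap_top pi : signed_perm m.+2 := ((pi.1 * tperm penult ord_max)%g, pi.2).

Lemma swap_topK : involutive swap_top.
Proof. by case=> s e; rewrite /swap_top /= -mulgA tperm2 mulg1. Qed.

Lemma swap_topE pi i : (swap_top pi).1 i =
  (if pi.1 i == m :> nat then m.+1 else if pi.1 i == m.+1 :> nat then m else pi.1 i)
  :> nat.
Proof.
rewrite /swap_top /= permM; case: tpermP => [->|->|/eqP + /eqP].
- by rewrite penultE eqxx.
- by rewrite penultE /= (gtn_eqF (ltnSn m)) eqxx.
- move=> ip im; case: eqP => [ipm|_].
    by case/eqP: ip; apply: ord_inj; rewrite ipm penultE.
  by case: eqP => // imm; case/eqP: im; apply: val_inj.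
Qed.

Lemma swap_top_in_D pi : in_D (swap_top pi) = in_D pi.
Proof.
by congr (~~ odd _); apply: eq_card => i; rewrite !inE !window_lt0.
Qed.

(** No value lies between the two exchanged ones, so only the pair of positions carrying them
    changes its inversion status. *)
Lemma swap_top_parity pi : inv_parity (swap_top pi).1 = ~~ inv_parity pi.1.
Proof.
pose x := ((pi.1)^-1)%g penult; pose y := ((pi.1)^-1)%g ord_max.
have sx : pi.1 x = m :> nat by rewrite permKV penultE.
have sy : pi.1 y = m.+1 :> nat by rewrite permKV.
have xy : x != y :> nat by apply: contra_eq_neq sx => /val_inj ->; rewrite sy; lia.
have inj i j : pi.1 i = pi.1 j :> nat -> i = j by move=> /val_inj/perm_inj.
(* The pair is put in increasing order, as only such pairs contribute. *)
pose p0 := if (x < y)%N then (x, y) else (y, x).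
rewrite /inv_parity (bigD1 p0) // [in RHS](bigD1 p0) //=.
rewrite -addNb; congr (_ (+) _).
  by rewrite !swap_topE /p0; case: ifP => /=; rewrite ?sx ?sy => xlt;
    rewrite !eqxx (gtn_eqF (ltnSn m)) ?ltnSn; move: xy xlt; clear; lia.
apply: eq_bigr => -[i j] /= p0ij; case: ltnP => //= ij.
have: ~ (pi.1 i = m :> nat /\ pi.1 j = m.+1 :> nat).
  move=> [si sj]; have ix : i = x by apply: inj; rewrite si.
  have jy : j = y by apply: inj; rewrite sj.
  by move: p0ij; rewrite /p0 -ix -jy ij eqxx.
have: ~ (pi.1 i = m.+1 :> nat /\ pi.1 j = m :> nat).
  move=> [si sj]; have iy : i = y by apply: inj; rewrite si.
  have jx : j = x by apply: inj; rewrite sj.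
  by move: p0ij; rewrite /p0 -iy -jx ltnNge (ltnW ij) eqxx.
rewrite !swap_topE; have := ltn_ord (pi.1 i); have := ltn_ord (pi.1 j).
move: (nat_of_ord (pi.1 i)) (nat_of_ord (pi.1 j)) => u v; clear.
by do ![case: ifP]; lia.
Qed.

(** The sign [odd m] follows the direction of the last step: a descent between positive entries for
    m even, an ascent between negative ones for m odd. *)
Definition top_last pi : bool :=
  [&& pi.1 penult == ord_max, pi.1 ord_max == penult,
      pi.2 penult == odd m & pi.2 ord_max == odd m].

Lemma swap_top_snake pi : snake pi -> snake (swap_top pi) = ~~ top_last pi.
Proof.
move=> /snakeP[s0 sS].
have bnd i := ltn_ord (pi.1 i).
have inj i j : pi.1 i = pi.1 j :> nat -> i = j :> nat.
  by move=> /val_inj/perm_inj ->.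
apply/snakeP/idP => [[_ sS'] | ntop].
  apply/negP => /and4P[/eqP sp /eqP sm /eqP ep /eqP em].
  have pm : (ord_max : 'I_m.+2) = penult.+1 :> nat by rewrite penultE.
  move: (sS _ _ pm) (sS' _ _ pm).
  rewrite !windowE !swap_topE sp sm penultE /= ep em eqxx (gtn_eqF (ltnSn m)) eqxx.
  by case: (odd m); lia.
split=> [i i0|i j ji].
  by have := s0 i i0; rewrite !windowE /=; case: (pi.2 i); lia.
have sij := sS i j ji.
(* Opposite signs decide the comparison whatever the absolute values. *)
have [eqe|] := boolP (pi.2 i == pi.2 j); last first.
  move: sij (bnd i) (bnd j); rewrite !windowE !swap_topE /=.
  move: (nat_of_ord (pi.1 i)) (nat_of_ord (pi.1 j)) => u v; clear.
  by case: (pi.2 i); case: (pi.2 j); case: (odd i) => //=; do ![case: ifP]; lia.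
(* With equal signs, only a comparison between the two top values themselves is reversed. *)
have [crit|] := boolP (((pi.1 i == m :> nat) && (pi.1 j == m.+1 :> nat)) ||
  ((pi.1 i == m.+1 :> nat) && (pi.1 j == m :> nat))); last first.
  move: sij eqe (bnd i) (bnd j); rewrite !windowE !swap_topE /=.
  move: (nat_of_ord (pi.1 i)) (nat_of_ord (pi.1 j)) => u v; clear.
  by case: (pi.2 i); case: (pi.2 j); case: (odd i) => //=; do ![case: ifP]; lia.
exfalso.
(* Otherwise the entry before position i would have to lie
   beyond both extreme entries. *)
have ei : pi.2 i = odd i.
  apply/eqP; apply: contraT => ei; case: (posnP i) => [i0|i_gt0].
    by have := s0 i i0; move: ei; rewrite windowE i0; case: (pi.2 i); lia.
  have hi : (i.-1 < m.+2)%N by apply: leq_ltn_trans (leq_pred i) (ltn_ord i).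
  have ih : i = (Ordinal hi).+1 :> nat by rewrite /= prednK.
  move: (Ordinal hi) ih => h ih.
  have := sS h i ih; have := bnd h.
  have : pi.1 h <> pi.1 i :> nat by move/inj; lia.
  have : pi.1 h <> pi.1 j :> nat by move/inj; lia.
  move: eqe ei sij crit; rewrite !windowE ih /=; clear.
  move: (nat_of_ord (pi.1 i)) (nat_of_ord (pi.1 j)) (nat_of_ord (pi.1 h)) => u v w.
  by case: (odd h); case: (pi.2 i); case: (pi.2 j); case: (pi.2 h) => //=; lia.
(* Likewise for an entry after position j. *)
have jE : j = m.+1 :> nat.
  apply/eqP; apply: contraT => jm.
  have hk : (j.+1 < m.+2)%N by have := ltn_ord j; lia.
  have kj : Ordinal hk = j.+1 :> nat by [].
  move: (Ordinal hk) kj => k kj.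
  have := sS j k kj; have := bnd k.
  have : pi.1 k <> pi.1 i :> nat by move/inj; lia.
  have : pi.1 k <> pi.1 j :> nat by move/inj; lia.
  move: eqe ei sij crit; rewrite !windowE ji /=; clear.
  move: (nat_of_ord (pi.1 i)) (nat_of_ord (pi.1 j)) (nat_of_ord (pi.1 k)) => u v w.
  by case: (odd i); case: (pi.2 i); case: (pi.2 j); case: (pi.2 k) => //=; lia.
have iE : i = m :> nat by lia.
have pE : penult = i by apply: ord_inj; rewrite penultE.
have mE : ord_max = j by apply: ord_inj.
(* With both signs equal to [odd m], the last comparison forces the larger absolute value to come
   first, which is [top_last]. *)
move: ntop; rewrite /top_last pE mE -(eqP eqe) ei iE eqxx !andbT => /negP[].
rewrite -!(inj_eq val_inj) /=.
move: eqe ei sij crit; rewrite !windowE iE jE.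
by case: (odd m); case: (pi.2 i); case: (pi.2 j) => //=; lia.
Qed.

(** * Extension of a snake by the two largest absolute values *)

(** The outer [lift_perm] gives the last position the value [penult]; the inner one gives position
    [penult] the value [lift penult ord_max], which is [ord_max]. *)
Definition append_top rho : signed_perm m.+2 :=
  (lift_perm ord_max penult (lift_perm ord_max ord_max rho.1),
   [ffun i : 'I_m.+2 => if unlift ord_max i is Some j then
      if unlift ord_max j is Some k then rho.2 k else odd m else odd m]).

Lemma append_top_wid rho i :
  (append_top rho).1 (wid i) = rho.1 i :> nat /\ (append_top rho).2 (wid i) = rho.2 i.
Proof.
rewrite /append_top /= ffunE /wid !liftK !lift_perm_lift; split=> //.
by rewrite /= /bump ltnn (leqNgt m) ltn_ord !add0n leqNgt ltn_ord.
Qed.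

Lemma append_top_penult rho :
  (append_top rho).1 penult = ord_max /\ (append_top rho).2 penult = odd m.
Proof.
split; last by rewrite /append_top /= ffunE /penult liftK unlift_none.
rewrite /append_top /= {2}/penult lift_perm_lift lift_perm_id; apply: ord_inj.
by rewrite /= /bump ltnn leqnn.
Qed.

Lemma append_top_max rho :
  (append_top rho).1 ord_max = penult /\ (append_top rho).2 ord_max = odd m.
Proof. by rewrite /append_top /= ffunE unlift_none lift_perm_id. Qed.

Lemma window_append_top rho i : window (append_top rho) (wid i) = window rho i.
Proof. by rewrite !windowE; have [-> ->] := append_top_wid rho i. Qed.

Lemma append_top_last rho : top_last (append_top rho).
Proof.
have [sp ep] := append_top_penult rho; have [sm em] := append_top_max rho.
by rewrite /top_last sp sm ep em !eqxx.
Qed.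

Lemma append_top_inj : injective append_top.
Proof.
move=> rho rho' eqr; apply: window_inj => i.
by rewrite -!window_append_top eqr.
Qed.

Lemma big_addb_pos (F : pred 'I_m.+2) :
  \big[addb/false]_i F i
    = \big[addb/false]_(i < m) F (wid i) (+) F penult (+) F ord_max.
Proof.
rewrite !big_ord_recr /=; congr (_ (+) _ (+) F _).
- by apply: eq_bigr => i _; congr F; apply: ord_inj; rewrite widE.
- by congr F; apply: ord_inj; rewrite penultE.
Qed.

Lemma append_top_in_D rho : in_D (append_top rho) = in_D rho.
Proof.
rewrite /in_D !odd_card big_addb_pos !window_lt0.
have [_ ->] := append_top_penult rho; have [_ ->] := append_top_max rho.
rewrite -addbA addbb addbF; congr (~~ _); apply: eq_bigr => i _.
by rewrite window_append_top.
Qed.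

(** The appended absolute values exceed all earlier ones, so their mutual inversion is the only new
    one. *)
Lemma append_top_parity rho : inv_parity (append_top rho).1 = ~~ inv_parity rho.1.
Proof.
have [sp _] := append_top_penult rho; have [sm _] := append_top_max rho.
have sw i : (append_top rho).1 (wid i) = rho.1 i :> nat.
  by have [] := append_top_wid rho i.
(* With the later position [j] outermost, the terms of the two new positions can be split off. *)
have E n (s : 'S_n) : inv_parity s =
    \big[addb/false]_(j < n) \big[addb/false]_(i < n) ((i < j)%N && (s j < s i)%N).
  by rewrite exchange_big pair_big.
rewrite !E; move: (append_top rho).1 sp sm sw => s sp sm sw.
rewrite big_addb_pos [X in _ (+) X (+) _]big1 => [|i _]; last first.
  by rewrite sp [(_ < s i)%N]ltnNge leq_ord andbF.
rewrite addbF big_addb_pos [X in X (+) _ (+) _]big1 => [|i _]; last first.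
  by rewrite sw sm penultE [(m < _)%N]ltnNge (ltnW (ltn_ord _)) andbF.
rewrite sm sp penultE !ltnn !ltnSn addbT; congr (~~ _).
(* For an old [j], the new positions come after it and contribute nothing. *)
apply: eq_bigr => j _; rewrite big_addb_pos penultE widE !sw.
rewrite ltnNge (ltnW (ltn_ord j)).
rewrite (leq_gtF (leq_trans (ltnW (ltn_ord j)) (leqnSn m))) !addbF.
by apply: eq_bigr => i _; rewrite widE sw.
Qed.

(** The entry placed right after [rho] is m + 2, reached by an ascent, for m even and -(m + 2),
    reached by a descent, for m odd; being extreme, it extends any snake. *)
Lemma append_top_snake rho : snake (append_top rho) = snake rho.
Proof.
have [sp ep] := append_top_penult rho; have [sm em] := append_top_max rho.
have ww := window_append_top rho.
apply/snakeP/snakeP => -[s0 sS]; split.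
- by move=> i i0; rewrite -ww; apply: s0; rewrite widE.
- by move=> i j ji; rewrite -!ww -(widE i); apply: sS; rewrite !widE.
- move=> i; case: (posP i) => [k||//]; rewrite ?widE ?ww; first exact: s0.
  (* For m = 0 this entry opens the word, and [odd 0] makes it positive. *)
  by rewrite penultE windowE sp ep => m0; rewrite {1}m0.
- move=> i j; case: (posP j) => [k||].
  + case: (posP i) => [l||]; rewrite ?penultE ?widE ?ww /= => ji.
    * exact: sS.
    * by have := ltn_ord k; lia.
    * by have := ltn_ord k; lia.
  + case: (posP i) => [l||]; rewrite penultE ?widE /= => ji; [|by lia|by lia].
    rewrite !windowE sp ep; have [-> ->] := append_top_wid rho l.
    rewrite (congr1 odd ji : odd m = ~~ odd l).
    by have := ltn_ord (rho.1 l); case: (odd l); case: (rho.2 l) => /=; lia.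
  + case: (posP i) => [l||] ji; last by move: ji => /=; lia.
      by move: ji; rewrite widE /=; have := ltn_ord l; lia.
    by rewrite !windowE sp sm ep em penultE /=; case: (odd m); lia.
Qed.

(** The two top values occupy the last two positions, so the truncated window has absolute values
    exactly 1, ..., m and [windowP] yields [rho]. *)
Lemma top_lastP pi : top_last pi -> exists rho, pi = append_top rho.
Proof.
case/and4P=> /eqP sp /eqP sm /eqP ep /eqP em.
have [|rho [rhow _]] := (windowP (fun i : 'I_m => window pi (wid i))).1.
  move=> k; split=> [/andP[k_gt0 km]|[i <-]].
    have hk : (k.-1 < m.+2)%N by lia.
    have [i] : exists i, pi.1 i = k.-1 :> nat.
      by exists ((pi.1)^-1%g (Ordinal hk)); rewrite permKV.
    case: (posP i) => [j sj||]; [|by rewrite sp /=; lia|by rewrite sm penultE; lia].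
    by exists j; rewrite absz_window sj prednK.
  rewrite absz_window /=.
  have inj j : pi.1 (wid i) = pi.1 j :> nat -> wid i = j :> nat.
    by move=> /ord_inj/perm_inj ->.
  move: (inj penult) (inj ord_max) (ltn_ord (pi.1 (wid i))) (ltn_ord i).
  rewrite sp sm penultE widE; clear; move: (nat_of_ord (pi.1 (wid i))) => u.
  by move=> /=; lia.
exists rho; apply: window_inj => i; case: (posP i) => [j||].
- by rewrite window_append_top rhow.
- by rewrite !windowE ep sp; have [-> ->] := append_top_penult rho.
- by rewrite !windowE em sm; have [-> ->] := append_top_max rho.
Qed.

Lemma signed_count_rec c : signed_count m.+2 c = - signed_count m c.
Proof.
rewrite /signed_count (bigID top_last) /= [X in _ + X](_ : _ = 0) ?addr0; last first.
  (* Reindexing by the involution flips every sign, so the snakes outside [top_last] cancel. *)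
  set S := \sum_(pi | _) _; suff : S = - S by lia.
  rewrite {1}/S (reindex_inj (inv_inj swap_topK)) -sumrN.
  apply: eq_big => [pi|pi _]; last by rewrite swap_top_parity signrN.
  rewrite swap_top_in_D andbAC [RHS]andbAC; congr (_ && _).
  (* Both sides express that [pi] and [swap_top pi] are snakes. *)
  have [spi|/negbTE nspi] := boolP (snake pi).
    rewrite -(swap_top_snake spi); have [sspi|//] := boolP (snake (swap_top pi)).
    by rewrite -(swap_top_snake sspi) swap_topK.
  have [sspi|//] := boolP (snake (swap_top pi)).
  by rewrite -(swap_top_snake sspi) swap_topK.
transitivity (\sum_(pi in append_top @: [set rho | snake rho && (in_D rho == c)])
    (-1) ^+ inv_parity pi.1 : int).
  apply: eq_bigl => pi; apply/andP/imsetP => [[spi /top_lastP[rho piE]]|[rho + ->]].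
    by exists rho => //; move: spi; rewrite piE inE append_top_snake append_top_in_D.
  by rewrite inE append_top_snake append_top_in_D append_top_last.
rewrite big_imset => [|? ? _ _]; last exact: append_top_inj.
rewrite -sumrN; apply: eq_big => [rho|rho _]; first by rewrite inE.
by rewrite append_top_parity signrN.
Qed.

End TopTwo.

(** The only snake is the positive word, empty for n = 0; it lies in D_n and has no inversion. *)
Lemma signed_count_small n c : (n < 2)%N -> signed_count n c = c%:Z.
Proof.
move=> n2; pose pos : signed_perm n := (1%g, [ffun=> false]).
have ord_eq (i j : 'I_n) : i = j.
  by apply: ord_inj; have := ltn_ord i; have := ltn_ord j; lia.
have D_pos : in_D pos.
  by rewrite /in_D eq_card0 // => i; rewrite !inE window_lt0 ffunE.
have snake_pos pi : snake pi = (pi == pos).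
  apply/snakeP/eqP => [[s0 _]|->]; last first.
    split=> [i _|i j ji]; first by rewrite windowE ffunE.
    by move: ji; rewrite (ord_eq j i); lia.
  apply: window_inj => i; have i0 : i = 0%N :> nat by have := ltn_ord i; lia.
  have := s0 i i0; rewrite !windowE ffunE (ord_eq (pi.1 i) (pos.1 i)).
  by case: (pi.2 i).
rewrite /signed_count (eq_bigl (fun pi => (pi == pos) && c)) => [|pi]; last first.
  by rewrite snake_pos; case: eqP => //= ->; rewrite D_pos; case: c.
case: c => /=; last by rewrite big_pred0 // => pi; rewrite andbF.
rewrite (big_pred1 pos) => [|pi]; last by rewrite andbT.
by rewrite /inv_parity big1 // => -[i j] _ /=; rewrite (ord_eq i j) ltnn.
Qed.

Theorem theorem67 :
  (forall n : nat, (3 <= n)%N ->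
     (S_D_plus n)%:Z - (S_D_minus n)%:Z
       = (S_D_minus (n - 2)%N)%:Z - (S_D_plus (n - 2)%N)%:Z
     /\
     (S_BD_plus n)%:Z - (S_BD_minus n)%:Z
       = (S_BD_minus (n - 2)%N)%:Z - (S_BD_plus (n - 2)%N)%:Z)
  /\
  (forall n : nat, (0 < n)%N ->
     (S_D_plus n)%:Z - (S_D_minus n)%:Z
       = (if (n == 0 %[mod 4]) || (n == 1 %[mod 4]) then 1 else -1)
     /\
     (S_BD_plus n)%:Z - (S_BD_minus n)%:Z = 0).
Proof.
(* The recurrence is applied [n./2] times, down to length 0 or 1. *)
have diff n c : signed_count n c = c%:Z * (-1) ^+ n./2.
  elim/ltn_ind: n => -[|[|n]] IH; try by rewrite signed_count_small // mulr1.
  by rewrite signed_count_rec IH // exprS mulN1r mulrN.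
split=> [[|[|n]] // _|n _].
  rewrite -[_ - (S_D_plus _)%:Z]opprB -[_ - (S_BD_plus _)%:Z]opprB.
  by rewrite !S_D_signed !S_BD_signed subn2 /= !signed_count_rec.
rewrite S_D_signed S_BD_signed !diff mul0r mul1r; split=> //.
(* The residues 0 and 1 modulo 4 are those with [n./2] even. *)
have -> : (n == 0 %[mod 4]) || (n == 1 %[mod 4]) = ~~ odd n./2 by lia.
by rewrite -signr_odd; case: (odd _).
Qed.
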